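(* Let $(\mathrm D)$ be a projectively singular system of degree $n$, let $a\in\mathbb{R}$ with $Y_n(a,1)=0$, and let $A$ be the infinitely removed point lying on the ''extremities'' of the straight line $x=ay$. If in addition (a) $W_{n-1}(a,1)\,\partial_xY_n(a,1)>0$; or (b) $W_{n-1}(a,1)\,\partial_xY_n(a,1)<0$; or (c) $\partial_xY_n(a,1)=0$ and $W_{n-1}(a,1)\,\partial_{xx}Y_n(a,1)\neq0$, then the equatorial contact $A$-trajectory of $(\mathrm D)$ in a sufficiently small neighbourhood of $A$ is located (apart from the point $A$ itself), respectively: (a) in the half-plane $y>0$; (b) in the half-plane $y<0$; (c) both in the half-plane $y>0$ and in the half-plane $y<0$ (passing from one to the other through $A$).
   Context: System $(\mathrm D)$ of degree $n$: $\frac{dx}{dt}=X(x,y)=\sum_{k=0}^n X_k(x,y)$, $\frac{dy}{dt}=Y(x,y)=\sum_{k=0}^n Y_k(x,y)$, where $X_k,Y_k$ are real homogeneous polynomials of degree $k$, $X_n$ and $Y_n$ are not both identically zero, and $X,Y$ are relatively prime (no common divisors other than real numbers). Put $W_i(x,y)=xY_i(x,y)-yX_i(x,y)$, $i=0,\dots,n$. The system is projectively singular if $W_n\equiv 0$ on $\mathbb{R}^2$ (this forces $n\ge1$). The projective phase plane $\mathbb{RP}(x,y)$ is the plane $(x,y)$ completed by the line at infinity, with charts $(x,y)$, $(\xi,\theta)=(\frac yx,\frac1x)$, $(\eta,\zeta)=(\frac1y,\frac xy)$. For a projectively singular system the trajectories in the chart $(\eta,\zeta)$ are those of the second projectively reduced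 system $$\frac{d\eta}{d\nu}=-\sum_{i=0}^n\eta^{n-i}Y_i(\zeta,1),\qquad \frac{d\zeta}{d\nu}=-\sum_{j=0}^{n-1}\eta^{n-j-1}W_j(\zeta,1).$$ The point at infinity on the ''extremities'' of the line $x=ay$ is the point at infinity of this line, i.e. $(\eta,\zeta)=(0,a)$. An equatorial contact point is a point of the line at infinity, not an equilibrium, at which the trajectory on $\mathbb{RP}(x,y)$ is tangent to the line at infinity; the equatorial contact $A$-trajectory is the trajectory on $\mathbb{RP}(x,y)$ passing through the equatorial contact point $A$. *)

(* Defs.v *)
From HB Require Import structures.
From mathcomp Require Import all_boot all_order all_algebra.
From mathcomp Require Import all_classical all_reals all_analysis.
(* The notations of mpoly clash with those of mathcomp-analysis. *)
From mathcomp Require Import -(notations) mpoly.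

Set Implicit Arguments.
Unset Strict Implicit.
Unset Printing Implicit Defensive.

Import Order.TTheory GRing.Theory Num.Theory.
Import numFieldNormedType.Exports.

Local Open Scope classical_set_scope.
Local Open Scope ring_scope.

(* In [mpoly 2 R] the variable of index 0 is x and the variable of index 1
   is y. *)
Definition polX (R : realType) : mpoly 2 R := mpolyX R (mnm1 (inord 0)).
Definition polY (R : realType) : mpoly 2 R := mpolyX R (mnm1 (inord 1)).

Definition eval2 (R : realType) (p : mpoly 2 R) (x y : R) : R :=
  meval (fun i : 'I_2 => if i == inord 0 then x else y) p.

Definition dx (R : realType) (p : mpoly 2 R) : mpoly 2 R := mderiv (inord 0) p.

(* Only the components of index k <= n are meaningful.  The zero polynomial
   satisfies [ishomog1 k mdeg] for every k. *)
Record polySystem (R : realType) (n : nat) := PolySystem {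
  Xk : nat -> mpoly 2 R;
  Yk : nat -> mpoly 2 R;
  Xk_homog : forall k, (k <= n)%N -> Xk k \is ishomog1 k mdeg;
  Yk_homog : forall k, (k <= n)%N -> Yk k \is ishomog1 k mdeg;
  top_neq0 : Xk n != 0 \/ Yk n != 0;
  XY_coprime : forall d p q : mpoly 2 R,
    \sum_(k < n.+1) Xk k = d * p -> \sum_(k < n.+1) Yk k = d * q ->
    exists c : R, d = mpolyC 2 c
}.

Definition Wk (R : realType) (n : nat) (D : polySystem R n) (i : nat) :
    mpoly 2 R :=
  polX R * Yk D i - polY R * Xk D i.

Definition projectively_singular (R : realType) (n : nat)
    (D : polySystem R n) : Prop :=
  forall x y : R, eval2 (Wk D n) x y = 0.

(* From here on, a point p : R * R is a point of the projective phase plane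
   given by its coordinates (eta, zeta) = (1/y, x/y); the line at infinity is
   eta = 0. *)

(* Right-hand side of the second projectively reduced system. *)
Definition reduced2 (R : realType) (n : nat) (D : polySystem R n)
    (p : R * R) : R * R :=
  (- \sum_(i < n.+1) p.1 ^+ (n - i) * eval2 (Yk D i) p.2 1,
   - \sum_(j < n) p.1 ^+ (n - j - 1) * eval2 (Wk D j) p.2 1).

(* A trajectory in the chart, parametrized by nu in an open interval J. *)
Definition trajectory (R : realType) (n : nat) (D : polySystem R n)
    (J : set R) (g : R -> R * R) : Prop :=
  [/\ open J, is_interval J &
      forall t, J t ->
        is_derive t (1 : R) (fun s => (g s).1) (reduced2 D (g t)).1 /\
        is_derive t (1 : R) (fun s => (g s).2) (reduced2 D (g t)).2].

(* Arc, contained in U and parametrized by J, of the trajectory that passes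
   through A (at the parameter value t0). *)
Definition trajectory_arc (R : realType) (n : nat) (D : polySystem R n)
    (A : R * R) (U : set (R * R)) (J : set R) (t0 : R) (g : R -> R * R) : Prop :=
  [/\ trajectory D J g, J t0, g t0 = A & forall t, J t -> U (g t)].

(* The point (a y, y) of the line x = a y has coordinates
   (eta, zeta) = (1/y, a), and y tends to infinity. *)
Definition infinity_point (R : realType) (a : R) : R * R := (0, a).

(* The trajectory through p has velocity [reduced2 D p] at p; the tangent
   direction of the line at infinity eta = 0 is (0, 1). *)
Definition equatorial_contact (R : realType) (n : nat) (D : polySystem R n)
    (p : R * R) : Prop :=
  [/\ p.1 = 0, reduced2 D p != (0, 0) & (reduced2 D p).1 = 0].

(* Inverse of (x, y) |-> (1/y, x/y), for p.1 != 0. *)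
Definition affine_point (R : realType) (p : R * R) : R * R :=
  (p.2 / p.1, 1 / p.1).

Definition upper_half_plane (R : realType) (p : R * R) : Prop :=
  p.1 != 0 /\ 0 < (affine_point p).2.

Definition lower_half_plane (R : realType) (p : R * R) : Prop :=
  p.1 != 0 /\ (affine_point p).2 < 0.

Definition located_near (R : realType) (n : nat) (D : polySystem R n)
    (A : R * R) (H : R * R -> Prop) : Prop :=
  exists2 U : set (R * R), nbhs A U &
    forall (J : set R) (t0 : R) (g : R -> R * R),
      trajectory_arc D A U J t0 g ->
      forall t, J t -> t != t0 -> H (g t).

(* The arc leaves H1 and enters H2 through A, where it is at t = t0. *)
Definition passes_from_to (R : realType) (J : set R) (t0 : R)
    (g : R -> R * R) (H1 H2 : R * R -> Prop) : Prop :=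
  (forall t, J t -> t < t0 -> H1 (g t)) /\
  (forall t, J t -> t0 < t -> H2 (g t)).

Definition crosses_near (R : realType) (n : nat) (D : polySystem R n)
    (A : R * R) (H1 H2 : R * R -> Prop) : Prop :=
  exists2 U : set (R * R), nbhs A U &
    forall (J : set R) (t0 : R) (g : R -> R * R),
      trajectory_arc D A U J t0 g ->
      passes_from_to J t0 g H1 H2 \/ passes_from_to J t0 g H2 H1.

(* Main.v *)
Require Import Defs.
From mathcomp Require Import all_boot all_order all_algebra.
From mathcomp Require Import all_classical all_reals all_analysis.
From mathcomp Require Import -(notations) mpoly.
From mathcomp Require Import ring lra zify.
Import Order.TTheory GRing.Theory Num.Theory.
Import numFieldNormedType.Exports.
Local Open Scope classical_set_scope.
Local Open Scope ring_scope.

Set Implicit Arguments.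
Unset Strict Implicit.
Unset Printing Implicit Defensive.

(** In the chart (eta, zeta) the line at infinity is eta = 0 and the sign of
    y = 1/eta is the sign of eta, so everything is about the sign of the
    function eta along a trajectory that is at A = (0, a) at time t0.  Write
    the reduced system as eta' = F, zeta' = G with F and G polynomials in
    (eta, zeta), and let L = F d/deta + G d/dzeta be the derivation along
    trajectories, so that the i-th derivative of eta in time is L^i eta
    evaluated on the trajectory.

    At A one has F = - Y_n(a, 1) = 0 and G = - W_(n-1)(a, 1) =: - w, and also
    dF/dzeta = - Y_n'(a, 1), d^2F/dzeta^2 = - Y_n''(a, 1), where the
    primes are derivatives in x.  Hence eta and L eta = F vanish at A, and
    L^2 eta = w Y_n'(a, 1) there; if Y_n'(a, 1) = 0 then
    L^3 eta = - w^2 Y_n''(a, 1) there.  So eta vanishes at A to order exactly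
    2 in the first two cases and 3 in the last one, along every trajectory
    through A.

    The neighbourhood required of A is the open set U on which L^m eta keeps
    its sign at A, m being that order.  On an arc inside U the m-th derivative
    of eta has this constant sign; integrating m times from t0, where the
    lower derivatives vanish, shows that eta has the sign of
    (t - t0)^m times it on the whole arc (lemma [sign_near_contact]).
    With m even the arc stays on one side of the line at infinity, with m odd
    it crosses the line. *)

(** * Signs of functions with prescribed derivatives *)

Lemma mvt_interval (R : realType) (J : set R) (f df : R -> R) (t0 t : R) :
  is_interval J -> J t0 -> J t -> t != t0 ->
  (forall s, J s -> is_derive s (1 : R) f (df s)) ->
  exists2 c, J c /\ 0 < (c - t0) * (t - t0) & f t - f t0 = df c * (t - t0).
Proof.
move=> Jint Jt0 Jt tt0 fdf.
have mvt u v : u < v -> J u -> J v ->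
    exists2 c, J c /\ u < c < v & f v - f u = df c * (v - u).
  move=> uv Ju Jv.
  have Jc c : u <= c <= v -> J c by exact: Jint.
  have [c c_uv ->] : exists2 c, c \in `]u, v[%R & f v - f u = df c * (v - u).
    apply: MVT => // [x|].
      by rewrite in_itv /= => /andP[ux xv]; apply/fdf/Jc; rewrite !ltW.
    apply: derivable_within_continuous => x.
    by rewrite in_itv /= => /Jc /fdf [].
  move: c_uv; rewrite in_itv /= => /andP[uc cv].
  by exists c => //; split; [apply: Jc; rewrite !ltW | rewrite uc].
have [t_lt|t_gt|/eqP] := ltgtP t t0; last by rewrite (negPf tt0).
- have [c [Jc /andP[tc ct0]] Ec] := mvt _ _ t_lt Jt Jt0.
  by exists c; [split=> // | lra]; rewrite nmulr_rgt0 ?subr_lt0.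
- have [c [Jc /andP[t0c ct]] Ec] := mvt _ _ t_gt Jt0 Jt.
  by exists c => //; split=> //; rewrite mulr_gt0 ?subr_gt0.
Qed.

(** One integration from [t0].  In the mean value theorem
    [f t = df c * (t - t0)] the intermediate point [c] lies on the same side of
    [t0] as [t], so [(c - t0) ^+ m] and [(t - t0) ^+ m] have the same sign. *)
Lemma sign_step (R : realType) (J : set R) (f df : R -> R) (t0 k : R)
    (m : nat) :
  is_interval J -> J t0 -> f t0 = 0 ->
  (forall s, J s -> is_derive s (1 : R) f (df s)) ->
  (forall s, J s -> s != t0 -> 0 < k * df s * (s - t0) ^+ m) ->
  forall t, J t -> t != t0 -> 0 < k * f t * (t - t0) ^+ m.+1.
Proof.
move=> Jint Jt0 ft0 fdf df_gt0 t Jt tt0.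
have [c [Jc ct]] := mvt_interval Jint Jt0 Jt tt0 fdf.
rewrite ft0 subr0 => ->.
have ct0 : c != t0.
  by apply/eqP => ct0; move: ct; rewrite ct0 subrr mul0r ltxx.
have sq_gt0 : 0 < (t - t0) ^+ 2 by rewrite exprn_even_gt0 // subr_eq0.
have := mulr_gt0 (mulr_gt0 (df_gt0 c Jc ct0) (exprn_gt0 m ct)) sq_gt0.
(* The positive factors ((c - t0) * (t - t0)) ^+ m and (t - t0) ^+ 2 turn the
   hypothesis at c into the goal at t times a positive square. *)
have -> : k * df c * (c - t0) ^+ m * ((c - t0) * (t - t0)) ^+ m * (t - t0) ^+ 2
        = (k * (df c * (t - t0)) * (t - t0) ^+ m.+1) * ((c - t0) ^+ m) ^+ 2.
  by move: (t - t0) (c - t0) => u v; rewrite exprMn [u ^+ m.+1]exprS; ring.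
by rewrite pmulr_lgt0 // exprn_even_gt0 //= expf_neq0 // subr_eq0.
Qed.

(** * Polynomial observables along trajectories *)

(** Statements about evaluation, derivatives and substitution need only be
    checked on the generators of the polynomial algebra. *)
Lemma mpoly_gen_ind (R : realType) (Q : mpoly 2 R -> Prop) :
  (forall c, Q (mpolyC 2 c)) -> Q (polX R) -> Q (polY R) ->
  (forall p q, Q p -> Q q -> Q (p + q)) ->
  (forall p q, Q p -> Q q -> Q (p * q)) ->
  forall p, Q p.
Proof.
move=> QC QX QY QD QM.
have Q1 : Q 1 by rewrite -mpolyC1.
have Qvar (i : 'I_2) : Q (mpolyX R (mnm1 i)).
  case: i => [[|[|//]]] lt_i2.
    by have -> : Ordinal lt_i2 = inord 0 by apply/val_inj; rewrite /= inordK.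
  by have -> : Ordinal lt_i2 = inord 1 by apply/val_inj; rewrite /= inordK.
apply: mpolyind => [|c m p _ _ Qp]; first by rewrite -mpolyC0.
apply: (QD) => //; rewrite -mul_mpolyC; apply: (QM) => //.
rewrite mpolyXE_id; apply: (big_ind Q) => // i _.
by elim: (m i) => [|e IH]; rewrite ?expr0 // exprS; apply: (QM).
Qed.

Definition dy (R : realType) (p : mpoly 2 R) : mpoly 2 R := mderiv (inord 1) p.

Lemma eval2D (R : realType) (p q : mpoly 2 R) x y :
  eval2 (p + q) x y = eval2 p x y + eval2 q x y.
Proof. exact: mevalD. Qed.

Lemma eval2N (R : realType) (p : mpoly 2 R) x y :
  eval2 (- p) x y = - eval2 p x y.
Proof. exact: mevalN. Qed.

Lemma eval2M (R : realType) (p q : mpoly 2 R) x y :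
  eval2 (p * q) x y = eval2 p x y * eval2 q x y.
Proof. exact: mevalM. Qed.

Lemma eval2C (R : realType) (c x y : R) : eval2 (mpolyC 2 c) x y = c.
Proof. exact: mevalC. Qed.

Lemma eval2X (R : realType) (x y : R) : eval2 (polX R) x y = x.
Proof. by rewrite /eval2 mevalXU eqxx. Qed.

Lemma inord01 : ((inord 1 : 'I_2) == inord 0) = false.
Proof. by apply/negbTE; rewrite -val_eqE /= !inordK. Qed.

Lemma eval2Y (R : realType) (x y : R) : eval2 (polY R) x y = y.
Proof. by rewrite /eval2 mevalXU inord01. Qed.

Definition eval2E := (eval2D, eval2N, eval2M, eval2C, eval2X, eval2Y).

Lemma mderivXU (R : realType) (i j : 'I_2) :
  mderiv i (mpolyX R (mnm1 j)) = mpolyC 2 (i == j)%:R.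
Proof.
rewrite mderivX mnm1E eq_sym; have [->|] := eqVneq.
  rewrite scale1r mpolyC1 -mpolyX0; congr (mpolyX R _).
  by apply/mnmP => l; rewrite mnmBE mnm0E subnn.
by rewrite scale0r mpolyC0.
Qed.

Lemma dxX (R : realType) : dx (polX R) = 1.
Proof. by rewrite /dx mderivXU eqxx mpolyC1. Qed.

Lemma dxY (R : realType) : dx (polY R) = 0.
Proof. by rewrite /dx mderivXU eq_sym inord01 mpolyC0. Qed.

Lemma dyX (R : realType) : dy (polX R) = 0.
Proof. by rewrite /dy mderivXU inord01 mpolyC0. Qed.

Lemma dyY (R : realType) : dy (polY R) = 1.
Proof. by rewrite /dy mderivXU eqxx mpolyC1. Qed.

Lemma continuous_eval2 (R : realType) (p : mpoly 2 R) :
  continuous (fun z : R * R => eval2 p z.1 z.2).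
Proof.
elim/mpoly_gen_ind: p => [c|||p q cp cq|p q cp cq] z.
- under eq_fun do rewrite eval2C; exact: cvg_cst.
- under eq_fun do rewrite eval2X; exact: cvg_fst.
- under eq_fun do rewrite eval2Y; exact: cvg_snd.
- under eq_fun do rewrite eval2D; exact: cvgD (cp z) (cq z).
- under eq_fun do rewrite eval2M; exact: cvgM (cp z) (cq z).
Qed.

(** The chain rule for polynomials of two functions of time. *)
Lemma is_derive_eval2 (R : realType) (p : mpoly 2 R) (f h : R -> R)
    (t df dh : R) :
  is_derive t (1 : R) f df -> is_derive t (1 : R) h dh ->
  is_derive t (1 : R) (fun s => eval2 p (f s) (h s))
    (eval2 (dx p) (f t) (h t) * df + eval2 (dy p) (f t) (h t) * dh).
Proof.
move=> f' h'.
elim/mpoly_gen_ind: p => [c|||p q p' q'|p q p' q'].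
- under eq_fun do rewrite eval2C.
  rewrite /dx /dy !mderivC -mpolyC0 !eval2C !mul0r addr0.
  exact: is_derive_cst.
- under eq_fun do rewrite eval2X.
  by rewrite dxX dyX -mpolyC0 -mpolyC1 !eval2C mul0r mul1r addr0.
- under eq_fun do rewrite eval2Y.
  by rewrite dxY dyY -mpolyC0 -mpolyC1 !eval2C mul0r mul1r add0r.
- have -> : (fun s => eval2 (p + q) (f s) (h s)) =
      (fun s => eval2 p (f s) (h s)) + (fun s => eval2 q (f s) (h s)).
    by apply/funext => s; exact: eval2D.
  apply: (is_derive_eq (is_deriveD p' q')).
  by rewrite /dx /dy !mderivD !eval2D; ring.
- have -> : (fun s => eval2 (p * q) (f s) (h s)) =
      (fun s => eval2 p (f s) (h s)) * (fun s => eval2 q (f s) (h s)).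
    by apply/funext => s; exact: eval2M.
  apply: (is_derive_eq (is_deriveM p' q')).
  by rewrite /dx /dy !mderivM !eval2E /GRing.scale /=; ring.
Qed.

(** The derivation along the field with components [F], [G]: by
    [is_derive_eval2], the time derivative of [p] along a trajectory is
    [lie F G p] evaluated on it. *)
Definition lie (R : realType) (F G p : mpoly 2 R) : mpoly 2 R :=
  dx p * F + dy p * G.

(** Induction on [m], applied to [lie F G p] in place of [p]: the derivative of
    [p] along the arc is [lie F G p], whose order of vanishing at [A] is one
    less, and [sign_step] integrates the sign obtained for it. *)
Lemma sign_of_contact (R : realType) (n : nat) (D : polySystem R n)
    (F G : mpoly 2 R) (A : R * R) (U : set (R * R)) (k : R) (m : nat)
    (p : mpoly 2 R) (J : set R) (t0 : R) (g : R -> R * R) :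
  (forall z, reduced2 D z = (eval2 F z.1 z.2, eval2 G z.1 z.2)) ->
  (forall i, (i < m)%N -> eval2 (iter i (lie F G) p) A.1 A.2 = 0) ->
  (forall z, U z -> 0 < k * eval2 (iter m (lie F G) p) z.1 z.2) ->
  trajectory_arc D A U J t0 g ->
  forall t, J t -> t != t0 -> 0 < k * eval2 p (g t).1 (g t).2 * (t - t0) ^+ m.
Proof.
move=> redE pA pU [[_ Jint g'] Jt0 gt0 gU].
elim: m p pA pU => [|m IH] p pA pU.
  by move=> t Jt _; rewrite expr0 mulr1; apply/pU/gU.
apply: (@sign_step R J _ (fun s => eval2 (lie F G p) (g s).1 (g s).2)) => //.
- by rewrite gt0; exact: pA 0 _.
- move=> s /g'; rewrite redE /= => -[f' h'].
  by rewrite /lie !eval2E; exact: is_derive_eval2.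
- apply: IH => [i im|z Uz]; first by rewrite -iterSr pA.
  by rewrite -iterSr; apply: pU.
Qed.

(** This neighbourhood depends only on the polynomial, hence serves all arcs
    through [A] at once. *)
Lemma nbhs_sign (R : realType) (p : mpoly 2 R) (k : R) (A : R * R) :
  0 < k * eval2 p A.1 A.2 ->
  nbhs A [set z : R * R | 0 < k * eval2 p z.1 z.2].
Proof.
move=> kpA; have := cvgr_gt _ (@continuous_eval2 R (mpolyC 2 k * p) A) 0.
rewrite eval2M eval2C => /(_ _ kpA).
by apply: filterS => z /=; rewrite eval2M eval2C.
Qed.

Lemma sign_near_contact (R : realType) (n : nat) (D : polySystem R n)
    (F G : mpoly 2 R) (A : R * R) (k : R) (m : nat) (p : mpoly 2 R) :
  (forall z, reduced2 D z = (eval2 F z.1 z.2, eval2 G z.1 z.2)) ->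
  (forall i, (i < m)%N -> eval2 (iter i (lie F G) p) A.1 A.2 = 0) ->
  0 < k * eval2 (iter m (lie F G) p) A.1 A.2 ->
  exists2 U : set (R * R), nbhs A U &
    forall J t0 g, trajectory_arc D A U J t0 g ->
      forall t, J t -> t != t0 ->
        0 < k * eval2 p (g t).1 (g t).2 * (t - t0) ^+ m.
Proof.
move=> redE pA kpA; eexists; first exact: nbhs_sign kpA.
by move=> J t0 g; apply: sign_of_contact redE pA _.
Qed.

(** * The reduced system as a polynomial vector field *)

(** The substitution (x, y) := (zeta, 1); the second variable of the polynomial
    ring now stands for the coordinate zeta. *)
Definition dehomog (R : realType) : mpoly 2 R -> mpoly 2 R :=
  mmap (@mpolyC 2 R) (fun i => if i == inord 0 then polY R else 1).

Lemma dehomogC (R : realType) (c : R) : dehomog (mpolyC 2 c) = mpolyC 2 c.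
Proof. exact: mmapC. Qed.

Lemma dehomogX (R : realType) : dehomog (polX R) = polY R.
Proof. by rewrite /dehomog mmapX mmap1U eqxx. Qed.

Lemma dehomogY (R : realType) : dehomog (polY R) = 1.
Proof. by rewrite /dehomog mmapX mmap1U inord01. Qed.

Lemma dehomogD (R : realType) (p q : mpoly 2 R) :
  dehomog (p + q) = dehomog p + dehomog q.
Proof. exact: mmapD. Qed.

Lemma dehomogM (R : realType) (p q : mpoly 2 R) :
  dehomog (p * q) = dehomog p * dehomog q.
Proof. exact: rmorphM. Qed.

Lemma eval2_dehomog (R : realType) (p : mpoly 2 R) x y :
  eval2 (dehomog p) x y = eval2 p y 1.
Proof.
elim/mpoly_gen_ind: p => [c|||p q Hp Hq|p q Hp Hq].
- by rewrite dehomogC !eval2C.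
- by rewrite dehomogX eval2Y eval2X.
- by rewrite dehomogY -mpolyC1 eval2Y eval2C.
- by rewrite dehomogD !eval2D Hp Hq.
- by rewrite dehomogM !eval2M Hp Hq.
Qed.

Lemma dy_dehomog (R : realType) (p : mpoly 2 R) :
  dy (dehomog p) = dehomog (dx p).
Proof.
elim/mpoly_gen_ind: p => [c|||p q Hp Hq|p q Hp Hq].
- by rewrite /dx /dy dehomogC !mderivC -mpolyC0 dehomogC.
- by rewrite dehomogX dyY dxX -mpolyC1 dehomogC.
- by rewrite dehomogY dxY -mpolyC1 -mpolyC0 dehomogC /dy mderivC.
- by rewrite /dx mderivD !dehomogD -Hp -Hq /dy mderivD.
- by rewrite /dx mderivM dehomogD !dehomogM -Hp -Hq /dy mderivM.
Qed.

(** The common shape of the two right-hand sides of the reduced system,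
    eta being the first variable: [m = n.+1] and [Q = Yk D] for eta',
    [m = n] and [Q = Wk D] for zeta'. *)
Definition reduced_component (R : realType) (m : nat) (Q : nat -> mpoly 2 R) :
    mpoly 2 R :=
  - \sum_(i < m) polX R ^+ (m - i - 1) * dehomog (Q i).

Lemma eval2_reduced_component (R : realType) (m : nat) (Q : nat -> mpoly 2 R)
    x y :
  eval2 (reduced_component m Q) x y
  = - \sum_(i < m) x ^+ (m - i - 1) * eval2 (Q i) y 1.
Proof.
rewrite eval2N /eval2 rmorph_sum; congr (- _); apply: eq_bigr => i _ /=.
rewrite rmorphM rmorphXn /= -!/(eval2 _ _ _) eval2X.
by congr (_ * _); exact: eval2_dehomog.
Qed.

(** On the line at infinity only the term with exponent 0 of eta survives. *)
Lemma eval2_reduced_component0 (R : realType) (m : nat) (Q : nat -> mpoly 2 R)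
    y :
  (0 < m)%N -> eval2 (reduced_component m Q) 0 y = - eval2 (Q m.-1) y 1.
Proof.
case: m => // m _.
rewrite eval2_reduced_component big_ord_recr /= big1 ?add0r => [|i _].
  by rewrite subSnn expr0 mul1r.
by rewrite expr0n (_ : (_ == 0)%N = false) ?mul0r //; have := ltn_ord i; lia.
Qed.

Lemma dy_reduced_component (R : realType) (m : nat) (Q : nat -> mpoly 2 R) :
  dy (reduced_component m Q) = reduced_component m (fun i => dx (Q i)).
Proof.
rewrite /reduced_component /dy mderivN; congr (- _).
rewrite raddf_sum; apply: eq_bigr => i _ /=.
rewrite mderivM -!/(dy _) dy_dehomog.
have -> : dy (polX R ^+ (m - i - 1)) = 0.
  elim: (_ - 1)%N => [|e IH]; first by rewrite expr0 -mpolyC1 /dy mderivC.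
  by rewrite exprS /dy mderivM -!/(dy _) dyX IH mul0r mulr0 addr0.
by rewrite mul0r add0r.
Qed.

Lemma reduced2E (R : realType) (n : nat) (D : polySystem R n) z :
  reduced2 D z = (eval2 (reduced_component n.+1 (Yk D)) z.1 z.2,
                  eval2 (reduced_component n (Wk D)) z.1 z.2).
Proof.
rewrite !eval2_reduced_component /reduced2; congr (_, _); congr (- _).
by apply: eq_bigr => i _; congr (_ ^+ _ * _); have := ltn_ord i; lia.
Qed.

Unset Implicit Arguments.

Theorem mainTheorem18 (R : realType) (n : nat) (D : polySystem R n) (a : R)
    (Dsing : projectively_singular D)
    (Yna : eval2 (Yk D n) a 1 = 0) :
  (0 < eval2 (Wk D n.-1) a 1 * eval2 (dx (Yk D n)) a 1 ->
     equatorial_contact D (infinity_point a) /\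
     located_near D (infinity_point a) (@upper_half_plane R)) /\
  (eval2 (Wk D n.-1) a 1 * eval2 (dx (Yk D n)) a 1 < 0 ->
     equatorial_contact D (infinity_point a) /\
     located_near D (infinity_point a) (@lower_half_plane R)) /\
  (eval2 (dx (Yk D n)) a 1 = 0 ->
   eval2 (Wk D n.-1) a 1 * eval2 (dx (dx (Yk D n))) a 1 != 0 ->
     equatorial_contact D (infinity_point a) /\
     crosses_near D (infinity_point a)
       (@upper_half_plane R) (@lower_half_plane R)).
Proof.
have [n0|n_gt0] := posnP n.
  (* Here n.-1 = n, and W_n vanishes identically: all three hypotheses are
     false. *)
  have -> : n.-1 = n by rewrite n0.
  by rewrite Dsing !mul0r ltxx eqxx.
set w := eval2 (Wk D n.-1) a 1.
set y1 := eval2 (dx (Yk D n)) a 1; set y2 := eval2 (dx (dx (Yk D n))) a 1.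
pose F := reduced_component n.+1 (Yk D); pose G := reduced_component n (Wk D).
have redE z : reduced2 D z = (eval2 F z.1 z.2, eval2 G z.1 z.2).
  exact: reduced2E.
have FA : eval2 F 0 a = 0 by rewrite eval2_reduced_component0 //= Yna oppr0.
have GA : eval2 G 0 a = - w.
  by rewrite eval2_reduced_component0.
have dyFA : eval2 (dy F) 0 a = - y1.
  by rewrite dy_reduced_component eval2_reduced_component0.
have dyyFA : eval2 (dy (dy F)) 0 a = - y2.
  by rewrite !dy_reduced_component eval2_reduced_component0.
(* F and G are made opaque so that evaluation rules do not unfold them. *)
clearbody F G.
have lieX : lie F G (polX R) = F.
  by rewrite /lie dxX dyX mul1r mul0r addr0.
have lieFA : eval2 (lie F G F) 0 a = w * y1.
  by rewrite /lie !eval2E FA GA dyFA; ring.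
have lie2FA : y1 = 0 -> eval2 (lie F G (lie F G F)) 0 a = - (w ^+ 2 * y2).
  move=> y10; rewrite {1}/lie !eval2E FA GA {2}/lie /dy mderivD !mderivM.
  by rewrite -!/(dy _) !eval2E FA GA dyFA dyyFA y10; ring.
have contact : w != 0 -> equatorial_contact D (infinity_point a).
  move=> w0; split=> //; rewrite redE /= FA ?GA //.
  by rewrite xpair_eqE oppr_eq0 (negPf w0) andbF.
have upperE (z : R * R) : 0 < z.1 -> upper_half_plane z.
  by move=> z0; split; rewrite ?gt_eqF //= div1r invr_gt0.
have lowerE (z : R * R) : z.1 < 0 -> lower_half_plane z.
  by move=> z0; split; rewrite ?lt_eqF //= div1r invr_lt0.
have vanish (i : nat) : (i < 2)%N ->
    eval2 (iter i (lie F G) (polX R)) (infinity_point a).1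
      (infinity_point a).2 = 0.
  by case: i => [|[|//]] _ /=; rewrite ?lieX ?eval2X.
split; [|split].
- move=> wy1; split.
    by apply/contact/eqP => w0; rewrite w0 mul0r ltxx in wy1.
  have [|U AU sign] := sign_near_contact (k := 1) redE vanish.
    by rewrite /= lieX lieFA mul1r.
  exists U => // J t0 g arc t Jt tt0; apply: upperE.
  have := sign J t0 g arc t Jt tt0.
  by rewrite eval2X mul1r pmulr_lgt0 // exprn_even_gt0 // subr_eq0.
- move=> wy1; split.
    by apply/contact/eqP => w0; rewrite w0 mul0r ltxx in wy1.
  have [|U AU sign] := sign_near_contact (k := -1) redE vanish.
    by rewrite /= lieX lieFA mulN1r oppr_gt0.
  exists U => // J t0 g arc t Jt tt0; apply: lowerE.
  have := sign J t0 g arc t Jt tt0.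
  rewrite eval2X mulN1r pmulr_lgt0 ?oppr_gt0 //.
  by rewrite exprn_even_gt0 // subr_eq0.
- move=> y10; rewrite mulf_eq0 negb_or => /andP[w0 y20].
  split; first exact: contact.
  (* k is the third derivative of eta at A, so k times itself is positive. *)
  set k := - (w ^+ 2 * y2).
  have k0 : k != 0 by rewrite oppr_eq0 mulf_neq0 // expf_neq0.
  have vanish3 (i : nat) : (i < 3)%N ->
      eval2 (iter i (lie F G) (polX R)) (infinity_point a).1
        (infinity_point a).2 = 0.
    case: i => [|[|[|//]]] _ /=; rewrite ?lieX ?eval2X //.
    by rewrite lieFA y10 mulr0.
  have [|U AU sign] := sign_near_contact (k := k) redE vanish3.
    by rewrite /= lieX lie2FA // -/k -expr2 exprn_even_gt0.
  exists U => // J t0 g arc.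
  have arc_sign t : J t -> t != t0 -> 0 < k * (g t).1 * (t - t0).
    move=> Jt tt0; have := sign J t0 g arc t Jt tt0.
    rewrite eval2X [_ ^+ 3]exprS mulrA pmulr_lgt0 //.
    by rewrite exprn_even_gt0 // subr_eq0.
  have below t : J t -> t < t0 -> k * (g t).1 < 0.
    move=> Jt tt0; have := arc_sign t Jt; rewrite lt_eqF // => /(_ isT).
    by rewrite nmulr_lgt0 ?subr_lt0.
  have above t : J t -> t0 < t -> 0 < k * (g t).1.
    move=> Jt tt0; have := arc_sign t Jt; rewrite gt_eqF // => /(_ isT).
    by rewrite pmulr_lgt0 ?subr_gt0.
  have [k_gt0|k_lt0] : 0 < k \/ k < 0 by apply/orP; rewrite lt_total // eq_sym.
  + right; split=> t Jt tt0.
    * by apply: lowerE; have := below t Jt tt0; rewrite pmulr_rlt0.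
    * by apply: upperE; have := above t Jt tt0; rewrite pmulr_rgt0.
  + left; split=> t Jt tt0.
    * by apply: upperE; have := below t Jt tt0; rewrite nmulr_rlt0.
    * by apply: lowerE; have := above t Jt tt0; rewrite nmulr_rgt0.
Qed.
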